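(* Let $0<\varepsilon\le 1$ be fixed. The randomized two-party communication complexity of the following task is $\Omega(n^2)$: given a marriage market $(W,M,\succ_W,\succ_M)$ with full preference lists and $|W|=|M|=n$, where Alice holds $\succ_W$ and Bob holds $\succ_M$, output $\varepsilon n$ pairs $(w,m)\in W\times M$ each of which is contained in some stable marriage (respectively, in every stable marriage).
   Context: A marriage market with full preference lists: disjoint sets $W$, $M$ of size $n$, each woman has a total order on $M$ (profile $\succ_W$) and each man a total order on $W$ (profile $\succ_M$). A perfect marriage is a bijection between $W$ and $M$, identified with its set of pairs. A pair $(w,m)$ is blocking for $\mu$ if $w$ prefers $m$ to her spouse in $\mu$ and $m$ prefers $w$ to his spouse in $\mu$; $\mu$ is stable if it has no blocking pair. In two-party communication complexity, the cost of a protocol is the number of bits exchanged in the worst case; a randomized protocol must produce a correct output with probability at least $2/3$ on every input; the complexity is the least cost of such a protocol. The bound is asymptotic in $n$. *)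

(* Defs.v *)
From HB Require Import structures.
From mathcomp Require Import all_boot all_order all_algebra all_fingroup.
From mathcomp Require Import reals.

Set Implicit Arguments.
Unset Strict Implicit.
Unset Printing Implicit Defensive.

Import Order.TTheory GRing.Theory Num.Theory.

(* Women W = 'I_n, men M = 'I_n (two disjoint copies, by role).         *)
(* A total order of a woman w on M is encoded by a ranking permutation  *)
(* rW w : {perm 'I_n}; rank 0 is the most preferred:                    *)
(*   w prefers m to m'  <->  rW w m < rW w m'.                          *)
(* Symmetrically for men with rM.                                       *)

Definition profile (n : nat) := 'I_n -> {perm 'I_n}.

Definition prefers (n : nat) (r : profile n) (a b b' : 'I_n) : bool :=
  (r a b < r a b')%N.

(* A perfect marriage: mu w = husband of woman w; (mu^-1) m = wife of m. *)
Definition marriage (n : nat) := {perm 'I_n}.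

Definition blocking (n : nat) (rW rM : profile n) (mu : marriage n)
  (w m : 'I_n) : bool :=
  prefers rW w m (mu w) && prefers rM m w ((mu^-1)%g m).

Definition stable (n : nat) (rW rM : profile n) (mu : marriage n) : bool :=
  [forall w : 'I_n, forall m : 'I_n, ~~ blocking rW rM mu w m].

Definition in_some_stable (n : nat) (rW rM : profile n) (p : 'I_n * 'I_n)
  : bool :=
  [exists mu : marriage n, stable rW rM mu && (mu p.1 == p.2)].

Definition in_every_stable (n : nat) (rW rM : profile n) (p : 'I_n * 'I_n)
  : bool :=
  [forall mu : marriage n, stable rW rM mu ==> (mu p.1 == p.2)].

(* A deterministic protocol is a protocol tree: at an Alice node Alice  *)
(* sends the bit f x, at a Bob node Bob sends g y; leaves are labelled  *)
(* with the output.  Its cost (worst-case number of bits) is the depth. *)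

Inductive dproto (X Y O : Type) : Type :=
  | Leaf of O
  | ANode of (X -> bool) & dproto X Y O & dproto X Y O
  | BNode of (Y -> bool) & dproto X Y O & dproto X Y O.

Arguments Leaf {X Y O}.
Arguments ANode {X Y O}.
Arguments BNode {X Y O}.

Fixpoint run (X Y O : Type) (p : dproto X Y O) (x : X) (y : Y) : O :=
  match p with
  | Leaf o => o
  | ANode f l r => if f x then run l x y else run r x y
  | BNode g l r => if g y then run l x y else run r x y
  end.

Fixpoint depth (X Y O : Type) (p : dproto X Y O) : nat :=
  match p with
  | Leaf _ => 0
  | ANode _ l r => (maxn (depth l) (depth r)).+1
  | BNode _ l r => (maxn (depth l) (depth r)).+1
  end.

Local Open Scope ring_scope.

(* A (public-coin) randomized protocol: a finitely supported probability
   distribution over deterministic protocols, given as weighted list. *)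
Definition rproto (R : realType) (X Y O : Type) := seq (R * dproto X Y O).

Definition is_distribution (R : realType) (X Y O : Type)
  (D : rproto R X Y O) : Prop :=
  (forall q, q \in map fst D -> 0 <= q) /\ \sum_(q <- D) q.1 = 1.

Definition success_prob (R : realType) (X Y O : Type)
  (D : rproto R X Y O) (ok : O -> bool) (x : X) (y : Y) : R :=
  \sum_(q <- D | ok (run q.2 x y)) q.1.

Definition rcost (R : realType) (X Y O : Type) (D : rproto R X Y O) : nat :=
  \max_(q <- D) depth q.2.

Definition pair_ok (n : nat) (every : bool) (rW rM : profile n)
  (p : 'I_n * 'I_n) : bool :=
  if every then in_every_stable rW rM p else in_some_stable rW rM p.

Definition valid_output (R : realType) (eps : R) (n : nat) (every : bool)
  (rW rM : profile n) (S : {set 'I_n * 'I_n}) : bool :=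
  (eps * n%:R <= (#|S|)%:R) && [forall p in S, pair_ok every rW rM p].

Definition solves (R : realType) (eps : R) (n : nat) (every : bool)
  (D : rproto R (profile n) (profile n) {set 'I_n * 'I_n}) : Prop :=
  is_distribution D /\
  (forall rW rM : profile n,
    (exists S, valid_output eps every rW rM S) ->
    (2 / 3 : R) <= success_prob D (valid_output eps every rW rM) rW rM).

(* Main.v *)
Require Import Defs.
From HB Require Import structures.
From mathcomp Require Import all_boot all_order all_algebra all_fingroup.
From mathcomp Require Import reals sequences exp.
From mathcomp Require Import zify ring lra.
Set Implicit Arguments.
Unset Strict Implicit.
Unset Printing Implicit Defensive.

Import Order.TTheory GRing.Theory Num.Theory.
Local Open Scope ring_scope.

(** Unique disjointness on k^2 bits reduces to the problem, for k = eps n / 4.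
    Given x, y in K * K (with K of size k), let w_i rank {m_j : (i,j) in x}
    first and then m'_i, and let m_j rank {w_i : (i,j) in y} first and then w'_j,
    while m'_i and w'_j rank w_i and m_j first.  If x and y are disjoint, every
    stable marriage contains all (w_i, m'_i) and (w'_j, m_j).  If they meet in
    (i,j) only, w_i marries m_j and sets m'_i free, who starts a chain of
    displacements: u_0 prefers every m'_i to v_0, v_t ranks u_t, u_{t+1} first
    and u_{t+1} ranks v_t, v_{t+1} first.  So (u_t, v_t) is stable for all t, or
    for no t.  As the chain contains all but 2k < eps n women, any admissible
    output reveals which case holds.

    For unique disjointness, let D be a uniform set of coordinates, x a uniform
    subset of D and y one of its complement; an intersecting input is obtained by
    adding one coordinate i to both.  For a rectangle A * B and D, i fixed, let
    a0, a1 count the elements of A with i-th bit 0, 1, and b0, b1 those of B.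
    Then a1 b1 >= a0 b0 - |a1 - a0| b0 - a0 |b1 - b0|, and a rectangle that is
    not exponentially small has few biased coordinates, so that its mass on
    intersecting inputs is at least (about) 3/4 of its mass on disjoint ones. *)

(** * Corruption bound for unique disjointness *)

Section Corruption.
Variables (R : realType) (I : finType).
Implicit Types (A B : pred {set I}) (D : {set I}) (i : I).

(* [nsub], [nsub_with], [nsub_without] are the counts a0 + a1, a1, a0 above. *)
Definition nsub A D : R := \sum_(x : {set I} | A x && (x \subset D)) 1.
Definition nsub_with A i D : R :=
  \sum_(x : {set I} | A x && (x \subset D)) (i \in x)%:R.
Definition nsub_without A i D : R :=
  \sum_(x : {set I} | A x && (x \subset D)) (i \notin x)%:R.
Definition imbalance A i D : R := `|nsub_with A i D - nsub_without A i D|.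

Lemma nsub_ge0 A D : 0 <= nsub A D.
Proof. by rewrite sumr_ge0. Qed.

Lemma nsub_with_ge0 A i D : 0 <= nsub_with A i D.
Proof. by rewrite sumr_ge0. Qed.

Lemma nsub_without_ge0 A i D : 0 <= nsub_without A i D.
Proof. by rewrite sumr_ge0. Qed.

Lemma nsub_split A i D : nsub A D = nsub_with A i D + nsub_without A i D.
Proof.
by rewrite -big_split /=; apply: eq_bigr => x _; case: (i \in x); rewrite ?addr0 ?add0r.
Qed.

Lemma nsub_withoutE A i D : nsub_without A i D = nsub A (D :\ i).
Proof.
rewrite /nsub_without /nsub [LHS]big_mkcond [RHS]big_mkcond /=.
apply: eq_bigr => x _; rewrite subsetD1 andbA.
by case: (A x && _); case: (i \in x).
Qed.

Lemma nsub_le A D : nsub A D <= 2 ^+ #|D|.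
Proof.
rewrite -natrX -card_powerset -sum1_card natr_sum [leLHS]big_mkcond [leRHS]big_mkcond /=.
by apply: ler_sum => x _; rewrite powersetE; case: (A x); case: (x \subset D).
Qed.

(** Put v = 2 u^2 - u. Since e^v >= 1 + v, it suffices that (1 + u)(1 + v) = 1 + u^2 (1 + 2u) is at
    least 1, which is where u >= -1/2 enters. *)
Lemma expR_le_1Dx (u : R) : - (1 / 2) <= u -> expR (u - 2 * u ^+ 2) <= 1 + u.
Proof.
move=> hu; set v := 2 * u ^+ 2 - u.
have u1 : 0 < 1 + u by lra.
have v1 : 0 < 1 + v by rewrite /v; nra.
have -> : u - 2 * u ^+ 2 = - v by rewrite /v; ring.
rewrite expRN -[leLHS]mul1r ler_pdivrMr ?expR_gt0 //.
apply: (@le_trans _ _ ((1 + u) * (1 + v))); last first.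
  by rewrite ler_pM2l // expR_ge1Dx.
have -> : (1 + u) * (1 + v) = 1 + u ^+ 2 * (1 + 2 * u) by rewrite /v; ring.
have := sqr_ge0 u; nra.
Qed.

(* The product of the factors [1 + l s_i chi_i], with s_i the sign of the bias
   of coordinate i and chi_i = +1 or -1, has mean 1 over the subsets of D; on a
   family with large total bias it would be large on average by convexity. *)
Lemma sum_imbalance_le A D (l : R) : 0 < l <= 1 / 2 ->
  l * \sum_(i in D) imbalance A i D <=
  3 * l ^+ 2 * #|I|%:R * nsub A D + 2 ^+ #|D| * expR (- (l ^+ 2 * #|I|%:R)).
Proof.
move=> /andP[l0 l1].
pose s i : R := if nsub_without A i D <= nsub_with A i D then 1 else -1.
pose chi (x : {set I}) i : R := if i \in x then 1 else -1.
(* Outside D the factors are 0 and 1, so the product vanishes unless x is a subset of D, while the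
   sum over all x still factors. *)
pose F i : R := if i \in D then 1 + l * s i else 0.
pose G i : R := if i \in D then 1 - l * s i else 1.
have s2 i : s i = 1 \/ s i = -1 by rewrite /s; case: ifP; [left|right].
have sls i : - (1 / 2) <= l * s i <= 1 / 2 by case: (s2 i) => ->; apply/andP; split; lra.
have F0 i : 0 <= F i by rewrite /F; case: ifP => // _; have := sls i; lra.
have G0 i : 0 <= G i by rewrite /G; case: ifP => // _; have := sls i; lra.
have mean : \sum_(x : {set I}) \prod_i (if i \in x then F i else G i) = 2 ^+ #|D|.
  rewrite -(bigA_distr _ _ F G) -prodr_const [RHS]big_mkcond /=.
  apply: eq_bigr => i _; rewrite /F /G; case: ifP => _; ring.
pose z x := \sum_(i in D) (l * s i * chi x i - 2 * l ^+ 2).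
pose c : R := l ^+ 2 * #|I|%:R.
have lower (x : {set I}) : x \subset D ->
    expR (z x) <= \prod_i (if i \in x then F i else G i).
  move=> /subsetP xD; rewrite /z big_mkcond expR_sum /=.
  apply: ler_prod => i _; rewrite expR_ge0 /= /F /G /chi.
  case: (boolP (i \in D)) => [iD|iD]; last first.
    by rewrite (contraNF (xD i) iD) expR0.
  have h u : u = l \/ u = - l -> expR (u - 2 * l ^+ 2) <= 1 + u.
    move=> hu; have -> : l ^+ 2 = u ^+ 2 by case: hu => ->; ring.
    by apply: expR_le_1Dx; case: hu => ->; lra.
  case: (i \in x); first by rewrite mulr1; apply: h; case: (s2 i) => ->; rewrite ?mulrN mulr1; auto.
  by rewrite mulrN1; apply: h; case: (s2 i) => ->; rewrite ?mulrN mulr1 ?opprK; auto.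
(* The tangent to [expR] at c makes the bound linear in the biases. The final factor 3 collects 2
   from the quadratic loss in [z] and 1 from c. *)
have tang (x : {set I}) : x \subset D ->
    expR c * (1 + (z x - c)) <= \prod_i (if i \in x then F i else G i).
  move=> xD; apply: le_trans (lower x xD).
  rewrite -{2}(subrK c (z x)) expRD mulrC ler_pM2r ?expR_gt0 //.
  exact: expR_ge1Dx.
have tot : expR c * \sum_(x : {set I} | A x && (x \subset D)) (1 + (z x - c)) <= 2 ^+ #|D|.
  rewrite -mean mulr_sumr [leRHS](bigID (fun x => A x && (x \subset D))) /=.
  rewrite -[leLHS]addr0 lerD //.
    by apply: ler_sum => x /andP[_]; exact: tang.
  by apply: sumr_ge0 => x _; apply: prodr_ge0 => i _; case: ifP.
have sumz : \sum_(x : {set I} | A x && (x \subset D)) z x =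
    l * \sum_(i in D) imbalance A i D - 2 * l ^+ 2 * #|D|%:R * nsub A D.
  rewrite /z exchange_big /= mulr_sumr /nsub.
  rewrite -[X in _ - 2 * _ * X * _]sumr_const.
  rewrite -mulrA mulr_suml mulr_sumr -sumrB /=.
  apply: eq_bigr => i iD; rewrite sumrB mul1r mulr_sumr mulr1; congr (_ - _).
  rewrite -mulr_sumr -mulrA; congr (_ * _).
  have -> : \sum_(x : {set I} | A x && (x \subset D)) chi x i =
     nsub_with A i D - nsub_without A i D.
    by rewrite -sumrB; apply: eq_bigr => x _; rewrite /chi; case: (i \in x); rewrite ?subr0 ?sub0r.
  rewrite /imbalance /s; case: leP => h.
    by rewrite mul1r ger0_norm // subr_ge0.
  by rewrite mulN1r ltr0_norm // subr_lt0.
have DI : #|D|%:R <= #|I|%:R :> R by rewrite ler_nat max_card.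
rewrite big_split sumrB /= sumz -/(nsub A D) in tot.
have sumc : \sum_(x : {set I} | A x && (x \subset D)) c = c * nsub A D.
  by rewrite mulr_sumr; apply: eq_bigr => x _; rewrite mulr1.
rewrite sumc -ler_pdivlMl ?expR_gt0 // mulrC -expRN in tot.
have := ler_wpM2l (sqr_ge0 l) (ler_wpM2r (nsub_ge0 A D) DI).
rewrite -/c; move: tot; rewrite /c; set S := \sum_(_ in _) _; set a := nsub A D.
have a0 : 0 <= a by exact: nsub_ge0.
move: (expR _) => E; lra.
Qed.


(** Replacing a1, b1 by their minima with a0, b0 only lowers the product, and (a0 - d)(b0 - e) >= a0
    b0 - d b0 - a0 e for d, e >= 0. With the weights b0 and a0, both errors can be summed by
    [sum_imbalance_le]. *)
Lemma mul_perturb_ge (a0 a1 b0 b1 : R) :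
  0 <= a0 -> 0 <= a1 -> 0 <= b0 -> 0 <= b1 ->
  a0 * b0 - `|a1 - a0| * b0 - a0 * `|b1 - b0| <= a1 * b1.
Proof.
move=> ha0 ha1 hb0 hb1.
case: (lerP a0 a1) => ha; case: (lerP b0 b1) => hb; nra.
Qed.

(** The two products count the disjoint pairs for a partition with i on Alice's side and for the one
    with i moved to Bob's; without bias each would be 2 a0 b0. *)
Lemma mul_halves_le (a0 a1 b0 b1 : R) : 0 <= a0 -> 0 <= b0 ->
  (a1 + a0) * b0 + a0 * (b1 + b0) <=
  4 * (a0 * b0) + `|a1 - a0| * b0 + a0 * `|b1 - b0|.
Proof.
move=> ha0 hb0.
have := ler_wpM2r hb0 (ler_norm (a1 - a0)).
have := ler_wpM2l ha0 (ler_norm (b1 - b0)); lra.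
Qed.

Lemma sum_notin_setD1 i (F : {set I} -> R) :
  \sum_(D : {set I} | i \notin D) F D = \sum_(D : {set I} | i \in D) F (D :\ i).
Proof.
rewrite (reindex_onto (fun D => D :\ i) (fun D => i |: D)) /=; last first.
  by move=> D; exact: setU1K.
apply: eq_bigl => D; rewrite setD11 /=; apply/eqP/idP => [<-|]; first exact: setU11.
exact: setD1K.
Qed.

Lemma setC_setD1 i D : ~: (D :\ i) = i |: ~: D.
Proof. by rewrite setCD setUC. Qed.

(* Unnormalised input distributions: the total mass is 4^N for [meas0] (disjoint
   inputs) and N 4^N / 4 for [meas1] (inputs meeting in one point i), N = #|I|. *)
Definition meas0 (x y : {set I}) : R :=
  \sum_(D : {set I}) ((x \subset D) && (y \subset ~: D))%:R.
Definition meas1 (x y : {set I}) : R :=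
  \sum_(D : {set I}) \sum_(i in D)
    [&& i \in x, x \subset D, i \in y & y \subset i |: ~: D]%:R.

Lemma meas0_rect A B :
  \sum_(x : {set I} | A x) \sum_(y : {set I} | B y) meas0 x y = \sum_(D : {set I}) nsub A D * nsub B (~: D).
Proof.
under eq_bigr do rewrite exchange_big; rewrite exchange_big /=.
apply: eq_bigr => D _; rewrite /nsub [X in X * _]big_mkcondr [X in _ * X]big_mkcondr /=.
rewrite mulr_suml; apply: eq_bigr => x _; rewrite mulr_sumr; apply: eq_bigr => y _.
by case: (x \subset D); case: (y \subset _); rewrite /= ?mulr1 ?mulr0 ?mul0r.
Qed.

Lemma meas1_rect A B :
  \sum_(x : {set I} | A x) \sum_(y : {set I} | B y) meas1 x y =
  \sum_(D : {set I}) \sum_(i in D) nsub_with A i D * nsub_with B i (i |: ~: D).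
Proof.
under eq_bigr do rewrite exchange_big; rewrite exchange_big /=.
apply: eq_bigr => D _.
under eq_bigr do rewrite exchange_big; rewrite exchange_big /=.
apply: eq_bigr => i _.
rewrite /nsub_with [X in X * _]big_mkcondr [X in _ * X]big_mkcondr /=.
rewrite mulr_suml; apply: eq_bigr => x _; rewrite mulr_sumr; apply: eq_bigr => y _.
by case: (x \subset D); case: (y \subset _); case: (i \in x); case: (i \in y);
  rewrite /= ?mulr1 ?mulr0 ?mul0r.
Qed.

Lemma sum_setsE (c : R) : \sum_(D : {set I}) c = c * 2 ^+ #|I|.
Proof.
by rewrite sumr_const -[X in _ *+ X]cardsT -powersetT card_powerset cardsT
  -[LHS]mulr_natr natrX.
Qed.

Lemma exprn4 n : 4 ^+ n = 2 ^+ n * 2 ^+ n :> R.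
Proof. by rewrite -exprMn; congr (_ ^+ _); ring. Qed.

(** Both masses are compared with P, the sum of the products a0 b0: J >= P - U - V and N Z <= 4 P +
    U + V, so 4 J >= N Z - 5 (U + V). The bias sums U and V are each at most 3 l N Z + Q, and l <=
    1/120 turns the loss 30 l N Z into at most N Z / 4. *)
Lemma corruption (l : R) A B : 0 < l <= 1 / 120 ->
  - (10 / l * 4 ^+ #|I| * expR (- (l ^+ 2 * #|I|%:R))) <=
  \sum_(x : {set I} | A x) \sum_(y : {set I} | B y) (4 * meas1 x y - 3 / 4 * #|I|%:R * meas0 x y).
Proof.
move=> /andP[l0 l120]; under eq_bigr do rewrite sumrB -!mulr_sumr.
rewrite sumrB -!mulr_sumr meas1_rect meas0_rect.
set Z := \sum_(D : {set I}) nsub A D * _; set J := \sum_(D : {set I}) \sum_(i in D) _.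
pose N : R := #|I|%:R; rewrite -/N.
pose U := \sum_(D : {set I}) \sum_(i in D) imbalance A i D * nsub B (~: D).
pose V := \sum_(D : {set I}) \sum_(i in D) nsub A (D :\ i) * imbalance B i (i |: ~: D).
pose P := \sum_(D : {set I}) \sum_(i in D) nsub A (D :\ i) * nsub B (~: D).
have bD i (D : {set I}) : i \in D -> (i |: ~: D) :\ i = ~: D.
  by move=> iD; rewrite setU1K // inE iD.
have JP : P - U - V <= J.
  rewrite /P /U /V /J -!sumrB; apply: ler_sum => D _.
  rewrite -!sumrB; apply: ler_sum => i iD.
  have := @mul_perturb_ge (nsub_without A i D) (nsub_with A i D)
    (nsub_without B i (i |: ~: D)) (nsub_with B i (i |: ~: D))
    (nsub_without_ge0 _ _ _) (nsub_with_ge0 _ _ _)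
    (nsub_without_ge0 _ _ _) (nsub_with_ge0 _ _ _).
  by rewrite !nsub_withoutE bD // /imbalance !nsub_withoutE bD.
(* Moving i across the partition turns a sum over i outside D into one over i in D. *)
have swap (F : {set I} -> R) (G : {set I} -> I -> R):
  \sum_(D : {set I}) \sum_(i in ~: D) F D * G (~: D) i =
  \sum_(D : {set I}) \sum_(i in D) F (D :\ i) * G (i |: ~: D) i.
  under eq_bigr => D _ do under eq_bigl => i do rewrite inE.
  rewrite (exchange_big_dep xpredT) //= [RHS](exchange_big_dep xpredT) //=.
  apply: eq_bigr => i _; rewrite (sum_notin_setD1 i (fun D => F D * G (~: D) i)).
  by apply: eq_bigr => D _; rewrite setC_setD1.
have ZP : N * Z <= 4 * P + U + V.
  have -> : N * Z = \sum_(D : {set I}) \sum_(i in D) (nsub A D * nsub B (~: D) +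
       nsub A (D :\ i) * nsub B (i |: ~: D)).
    rewrite mulr_sumr; under [RHS]eq_bigr do rewrite big_split /=.
    rewrite big_split /= -(swap _ (fun D _ => nsub B D)) -big_split /=.
    apply: eq_bigr => D _; rewrite !sumr_const -mulrnDr cardsC /N mulrC.
    exact: mulr_natr.
  rewrite /P /U /V mulr_sumr -!big_split /=; apply: ler_sum => D _.
  rewrite [4 * _]mulr_sumr -!big_split /=; apply: ler_sum => i iD.
  have := @mul_halves_le (nsub_without A i D) (nsub_with A i D)
    (nsub_without B i (i |: ~: D)) (nsub_with B i (i |: ~: D))
    (nsub_without_ge0 _ _ _) (nsub_without_ge0 _ _ _).
  by rewrite -!nsub_split !nsub_withoutE bD // /imbalance !nsub_withoutE bD.
pose E := expR (- (l ^+ 2 * N)).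
have hl : 0 < l <= 1 / 2 by rewrite l0 /=; lra.
have E0 : 0 <= E by exact: expR_ge0.
have pow4 (D : {set I}) : 2 ^+ #|D| * 2 ^+ #|~: D| = 2 ^+ #|I| :> R.
  by rewrite -exprD cardsC.
have sum4 : \sum_(D : {set I}) (2 ^+ #|I| : R) = 4 ^+ #|I|.
  by rewrite sum_setsE exprn4.
have UB : l * U <= 3 * l ^+ 2 * N * Z + 4 ^+ #|I| * E.
  rewrite /U /Z !mulr_sumr -sum4 mulr_suml -big_split /=; apply: ler_sum => D _.
  rewrite -mulr_suml mulrA.
  apply: le_trans (ler_wpM2r (nsub_ge0 _ _) (sum_imbalance_le A D hl)) _.
  rewrite mulrDl -/N -/E !mulrA lerD2l -(pow4 D) -!mulrA.
  by rewrite ler_wpM2l ?exprn_ge0 // mulrC ler_wpM2r // nsub_le.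
have VB : l * V <= 3 * l ^+ 2 * N * Z + 4 ^+ #|I| * E.
  rewrite /V -(swap _ (fun D i => imbalance B i D)).
  rewrite /Z !mulr_sumr -sum4 mulr_suml -big_split /=; apply: ler_sum => D _.
  rewrite -mulr_sumr mulrCA.
  apply: le_trans (ler_wpM2l (nsub_ge0 _ _) (sum_imbalance_le B (~: D) hl)) _.
  rewrite mulrDr -/N -/E.
  have -> : nsub A D * (3 * l ^+ 2 * N * nsub B (~: D)) =
    3 * l ^+ 2 * N * (nsub A D * nsub B (~: D)) by ring.
  rewrite lerD2l -(pow4 D) !mulrA.
  by rewrite !ler_wpM2r ?exprn_ge0 // nsub_le.
have Z0 : 0 <= N * Z.
  by rewrite mulr_ge0 ?ler0n // sumr_ge0 // => D _; rewrite mulr_ge0 ?nsub_ge0.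
rewrite -/E; set X := 4 ^+ _ in UB VB *; pose Q := X * E / l.
have -> : 10 / l * X * E = 10 * Q by rewrite /Q; field; rewrite gt_eqF.
have lQ : l * Q = X * E by rewrite /Q; field; rewrite gt_eqF.
have UQ : U <= 3 * l * (N * Z) + Q by rewrite -(ler_pM2l l0) mulrDr lQ; lra.
have VQ : V <= 3 * l * (N * Z) + Q by rewrite -(ler_pM2l l0) mulrDr lQ; lra.
have := ler_wpM2r Z0 l120; lra.
Qed.

Lemma nsub_predT D : nsub predT D = 2 ^+ #|D|.
Proof.
rewrite -natrX -card_powerset -sum1_card natr_sum; apply: eq_bigl => x.
by rewrite powersetE.
Qed.

Lemma nsub_with_predT i D : i \in D -> nsub_with predT i D = 2 ^+ #|D :\ i|.
Proof.
move=> iD; have := nsub_split predT i D.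
rewrite nsub_withoutE !nsub_predT [in 2 ^+ #|D|](cardsD1 i) iD exprS => h; lra.
Qed.

Lemma meas0_total : \sum_(x : {set I}) \sum_(y : {set I}) meas0 x y = 4 ^+ #|I|.
Proof.
rewrite (meas0_rect predT predT) exprn4 -sum_setsE; apply: eq_bigr => D _.
by rewrite !nsub_predT -exprD cardsC.
Qed.

Lemma meas1_total :
  4 * \sum_(x : {set I}) \sum_(y : {set I}) meas1 x y = #|I|%:R * 4 ^+ #|I|.
Proof.
rewrite (meas1_rect predT predT).
have -> : \sum_(D : {set I}) \sum_(i in D)
    nsub_with predT i D * nsub_with predT i (i |: ~: D) =
    \sum_(D : {set I}) \sum_(i in D) (2 ^+ #|I| / 2).
  apply: eq_bigr => D _; apply: eq_bigr => i iD.
  rewrite !nsub_with_predT ?setU11 // setU1K ?inE ?iD // -(cardsC D) (cardsD1 i D) iD.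
  by rewrite !exprD; field.
rewrite (exchange_big_dep xpredT) //=.
(* Removing i is a bijection, so exactly half of the sets D contain i. *)
rewrite (eq_bigr (fun _ => 4 ^+ #|I| / 4)); last first.
  move=> i _; have := sum_setsE (2 ^+ #|I| / 2).
  rewrite (bigID (fun D => i \in D)) /= sum_notin_setD1 exprn4 => h; lra.
by rewrite sumr_const -[X in 4 * X]mulr_natr; field.
Qed.

Lemma meas0_ge0 x y : 0 <= meas0 x y.
Proof. by rewrite sumr_ge0. Qed.

Lemma meas1_ge0 x y : 0 <= meas1 x y.
Proof. by rewrite sumr_ge0 // => D _; rewrite sumr_ge0. Qed.

Lemma meas0_support x y : x :&: y != set0 -> meas0 x y = 0.
Proof.
move=> xy; rewrite /meas0 big1 // => D _; case: andP => //= -[xD yD].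
case/set0Pn: xy => i; rewrite inE => /andP[/(subsetP xD) + /(subsetP yD)].
by rewrite inE => ->.
Qed.

Lemma meas1_support x y : (forall i, x :&: y != [set i]) -> meas1 x y = 0.
Proof.
move=> xy; rewrite /meas1 big1 // => D _; rewrite big1 // => i iD.
case: and4P => //= -[ix xD iy yD]; case/negP: (xy i).
rewrite eqEsubset sub1set inE ix iy !andbT; apply/subsetP => j; rewrite !inE.
by move=> /andP[/(subsetP xD) jD /(subsetP yD)]; rewrite !inE jD orbF.
Qed.

End Corruption.

(** * From rectangles to randomized protocols *)

(** The leaves cut the inputs into at most 2^depth rectangles, and each accepting one loses at most
    K. The rectangle A, B is arbitrary because every bit sent restricts one of its sides. *)
Lemma sum_accepted_ge (R : realType) (X Y O : Type) (S T : finType)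
    (f : S -> X) (g : T -> Y) (h : pred O) (nu : S -> T -> R) (K : R)
    (p : dproto X Y O) (A : pred S) (B : pred T) :
  0 <= K ->
  (forall (A : pred S) (B : pred T),
    - K <= \sum_(x | A x) \sum_(y | B y) nu x y) ->
  - (2 ^+ depth p * K) <=
  \sum_(x | A x) \sum_(y | B y) (h (run p (f x) (g y)))%:R * nu x y.
Proof.
move=> K0 rect.
have step (a b : nat) (u v : R) : - (2 ^+ a * K) <= u -> - (2 ^+ b * K) <= v ->
    - (2 ^+ (maxn a b).+1 * K) <= u + v.
  move=> hu hv; rewrite exprS.
  have ha : 2 ^+ a * K <= 2 ^+ maxn a b * K.
    by rewrite ler_wpM2r // ler_weXn2l ?leq_maxl // ler1n.
  have hb : 2 ^+ b * K <= 2 ^+ maxn a b * K.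
    by rewrite ler_wpM2r // ler_weXn2l ?leq_maxr // ler1n.
  lra.
elim: p A B => [o|fx l IHl r IHr|gy l IHl r IHr] A B /=.
- rewrite expr0 mul1r; case: (h o).
    by under eq_bigr do under eq_bigr do rewrite mul1r.
  under eq_bigr do under eq_bigr do rewrite mul0r.
  by rewrite big1 ?oppr_le0 // => x _; rewrite big1.
- rewrite (bigID (fx \o f)) /=; apply: step.
    apply: le_trans (IHl [pred x | A x && fx (f x)] B) _.
    by apply: ler_sum => x /andP[_ ->].
  apply: le_trans (IHr [pred x | A x && ~~ fx (f x)] B) _.
  by apply: ler_sum => x /andP[_ /negbTE ->].
rewrite exchange_big (bigID (gy \o g)) /=; apply: step.
  apply: le_trans (IHl A [pred y | B y && gy (g y)]) _.
  by rewrite exchange_big; apply: ler_sum => y /andP[_ ->].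
apply: le_trans (IHr A [pred y | B y && ~~ gy (g y)]) _.
by rewrite exchange_big; apply: ler_sum => y /andP[_ /negbTE ->].
Qed.

Lemma rproto_sum (R : realType) (X Y O : Type) (D : rproto R X Y O) :
  is_distribution D ->
  exists (m : nat) (w : 'I_m -> R) (p : 'I_m -> dproto X Y O),
  [/\ forall i, 0 <= w i, \sum_i w i = 1, forall i, (depth (p i) <= rcost D)%N
    & forall ok x y, success_prob D ok x y = \sum_i w i * (ok (run (p i) x y))%:R].
Proof.
move=> [D0 D1]; exists (size D), (fun i => (tnth (in_tuple D) i).1),
  (fun i => (tnth (in_tuple D) i).2); split.
- by move=> i; apply: D0; rewrite -tnth_map mem_tnth.
- by rewrite -D1 [RHS]big_tnth.
- by move=> i; rewrite /rcost big_tnth; exact: (leq_bigmax i).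
- move=> ok x y; rewrite /success_prob big_tnth big_mkcond /=; apply: eq_bigr => i _.
  by case: (ok _); rewrite ?mulr1 ?mulr0.
Qed.

(** The expected [nu]-weight of the accepted inputs is estimated twice: from below by rectangles, as
    cheap protocols cannot make it very negative, and from above by correctness. *)
Lemma udisj_lower_bound (R : realType) (I : finType) (X Y O : Type)
    (D : rproto R X Y O) (f : {set I} -> X) (g : {set I} -> Y) (h : pred O) (l : R) :
  0 < l <= 1 / 120 -> (0 < #|I|)%N -> is_distribution D ->
  (forall x y : {set I}, x :&: y = set0 -> 2 / 3 <= success_prob D h (f x) (g y)) ->
  (forall (x y : {set I}) i, x :&: y = [set i] ->
     success_prob D h (f x) (g y) <= 1 / 3) ->
  l ^+ 2 * #|I|%:R - 60 / l <= (rcost D)%:R :> R.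
Proof.
move=> hl I0 /rproto_sum[m [w [p [w0 w1 pd pE]]]] acc rej.
set C := rcost D in pd *; pose N : R := #|I|%:R; rewrite -/N.
pose nu (x y : {set I}) : R := 4 * meas1 R x y - 3 / 4 * N * meas0 R x y.
pose K : R := 10 / l * 4 ^+ #|I| * expR (- (l ^+ 2 * N)).
have [l0 _] := andP hl.
have K0 : 0 <= K by rewrite !mulr_ge0 ?expR_ge0 ?exprn_ge0 ?invr_ge0 ?ltW.
have lower : - (2 ^+ C * K) <=
    \sum_i w i * \sum_(x : {set I}) \sum_(y : {set I})
      (h (run (p i) (f x) (g y)))%:R * nu x y.
  have -> : - (2 ^+ C * K) = \sum_i w i * - (2 ^+ C * K) by rewrite -mulr_suml w1 mul1r.
  apply: ler_sum => i _; rewrite ler_wpM2l //.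
  apply: le_trans (sum_accepted_ge f g h (p i) predT predT K0
    (fun A B => corruption A B hl)).
  by rewrite lerN2 ler_wpM2r // ler_weXn2l ?ler1n.
have upper : \sum_i w i * \sum_(x : {set I}) \sum_(y : {set I})
      (h (run (p i) (f x) (g y)))%:R * nu x y <= - (1 / 6) * N * 4 ^+ #|I|.
  (* Acceptance is at least 2/3 where [meas0] lives and at most 1/3 where [meas1] lives; by the
     total masses this gives N 4^N (1/3 - 1/2). *)
  have -> : - (1 / 6) * N * 4 ^+ #|I| =
    \sum_(x : {set I}) \sum_(y : {set I})
      (4 / 3 * meas1 R x y - 1 / 2 * N * meas0 R x y).
    under eq_bigr do rewrite sumrB -!mulr_sumr.
    rewrite sumrB -!mulr_sumr meas0_total.
    have := meas1_total R I; rewrite -/N => h1; lra.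
  under eq_bigr do rewrite mulr_sumr; rewrite exchange_big /=.
  apply: ler_sum => x _.
  under eq_bigr do rewrite mulr_sumr; rewrite exchange_big /=.
  apply: ler_sum => y _.
  under eq_bigr do rewrite mulrA; rewrite -mulr_suml -pE /nu.
  have N0 : 0 <= N by rewrite ler0n.
  have m0 := meas0_ge0 R x y; have m1 := meas1_ge0 R x y.
  have [xy|xy] := eqVneq (x :&: y) set0.
    rewrite (@meas1_support _ _ x y); last first.
      by move=> i; rewrite xy eq_sym; apply/set0Pn; exists i; rewrite inE.
    have := acc x y xy; move: (success_prob _ _ _ _) => s hs.
    have := mulr_ge0 N0 m0; nra.
  rewrite (@meas0_support _ _ x y) // !mulr0 !subr0.
  have [/existsP[i /eqP xyi]|/existsPn xyi] := boolP [exists i, x :&: y == [set i]].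
    have := rej x y i xyi; move: (success_prob _ _ _ _) => s hs; nra.
  by rewrite meas1_support // !mulr0.
have N1 : 1 <= N by rewrite ler1n.
have P4 : 0 < 4 ^+ #|I| :> R by rewrite exprn_gt0.
have key : 1 <= 60 / l * 2 ^+ C * expR (- (l ^+ 2 * N)).
  have := le_trans lower upper; rewrite /K.
  have -> : 2 ^+ C * (10 / l * 4 ^+ #|I| * expR (- (l ^+ 2 * N))) =
    10 / l * 2 ^+ C * expR (- (l ^+ 2 * N)) * 4 ^+ #|I| by ring.
  rewrite -mulNr ler_pM2r // => hk; lra.
(* The crude bounds 2 <= e and 60/l <= e^(60/l) bring all factors of [key] into one exponent. *)
have C2 : 2 ^+ C <= expR (C%:R : R).
  rewrite -[C%:R]mulr1 expRM_natl lerXn2r ?nnegrE ?expR_ge0 //.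
  have := expR_ge1Dx (1 : R); lra.
have l60 : 0 <= 60 / l by rewrite divr_ge0 // ltW.
have e60 : 60 / l <= expR (60 / l) by have := expR_ge1Dx (60 / l); lra.
have : 1 <= expR (60 / l + C%:R - l ^+ 2 * N).
  rewrite !expRD; apply: le_trans key _; rewrite ler_wpM2r ?expR_ge0 //.
  by rewrite ler_pM ?exprn_ge0.
by rewrite -expR0 ler_expR => hh; lra.
Qed.

(** * Markets given by scores *)

Section ScoreRank.
Variables (n : nat) (f : 'I_n -> nat).

(* Ties in the score are broken by the index. *)
Definition score_key (a : 'I_n) : nat := (f a * n + a)%N.

Lemma score_key_inj : injective score_key.
Proof.
move=> a b /(congr1 (modn^~ n)); rewrite /score_key !modnMDl !modn_small //.
exact: val_inj.
Qed.

Lemma score_key_lt a b : (f a < f b)%N -> (score_key a < score_key b)%N.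
Proof. by rewrite /score_key => ab; have := ltn_ord a; nia. Qed.

Definition score_below (a : 'I_n) := [set b | (score_key b < score_key a)%N].

Lemma card_score_below a : (#|score_below a| < n)%N.
Proof.
rewrite -[X in (_ < X)%N]card_ord -cardsT proper_card //.
by rewrite properT; apply/negP => /eqP/setP/(_ a); rewrite !inE ltnn.
Qed.

Definition score_pos (a : 'I_n) : 'I_n := Ordinal (card_score_below a).

Lemma score_pos_lt a b : (score_key a < score_key b)%N -> (score_pos a < score_pos b)%N.
Proof.
move=> ab; rewrite proper_card // properE; apply/andP; split.
  by apply/subsetP => c; rewrite !inE => /ltn_trans; apply.
by apply/negP => /subsetP/(_ a); rewrite !inE ab ltnn => /(_ isT).
Qed.

Lemma score_pos_inj : injective score_pos.
Proof.
move=> a b ab; apply: score_key_inj.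
by case: (ltngtP (score_key a) (score_key b)) => // /score_pos_lt; rewrite ab ltnn.
Qed.

Definition score_rank : {perm 'I_n} := perm score_pos_inj.

Lemma score_rank_lt a b : (f a < f b)%N -> (score_rank a < score_rank b)%N.
Proof. by move=> /score_key_lt/score_pos_lt; rewrite !permE. Qed.

End ScoreRank.

Section ScoreMarket.
Variables (T : finType) (sW sM : T -> T -> nat).

Definition score_profile (s : T -> T -> nat) : profile #|T| :=
  fun a => score_rank (fun b => s (enum_val a) (enum_val b)).

Let rW := score_profile sW.
Let rM := score_profile sM.

Lemma score_prefers s a b b' :
  (s (enum_val a) (enum_val b) < s (enum_val a) (enum_val b'))%N ->
  prefers (score_profile s) a b b'.
Proof.
exact: (@score_rank_lt _ (fun c : 'I_#|T| => s (enum_val a) (enum_val c))).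
Qed.

Lemma prefers_score s a b b' :
  prefers (score_profile s) a b b' -> (s (enum_val a) (enum_val b) <= s (enum_val a) (enum_val b'))%N.
Proof.
move=> h; rewrite leqNgt; apply/negP => lt; move: h; apply/negP.
by have := score_prefers lt; rewrite /prefers -leqNgt => /ltnW.
Qed.

Definition spouse (mu : marriage #|T|) (t : T) : T := enum_val (mu (enum_rank t)).

Lemma spouse_inj mu : injective (spouse mu).
Proof. by move=> a b /enum_val_inj/perm_inj/enum_rank_inj. Qed.

(* The man of the pair (w, m) is described by his wife w', so m = h w'. *)
Definition score_unblocked (h : T -> T) : Prop := forall w w' : T,
  ~ ((sW w (h w') < sW w (h w))%N /\ (sM (h w') w < sM (h w') w')%N).
(** Here ties count as blocking, in [score_unblocked] they do not. Hence, however ties are broken,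
    [score_stable] implies stability, which implies [score_unblocked]. *)
Definition score_stable (h : T -> T) : Prop := forall w w' : T, w != w' ->
  ~ ((sW w (h w') <= sW w (h w))%N /\ (sM (h w') w <= sM (h w') w')%N).

Lemma stable_score_unblocked mu : stable rW rM mu -> score_unblocked (spouse mu).
Proof.
move=> /forallP st w w' [h1 h2].
have /forallP/(_ (mu (enum_rank w'))) := st (enum_rank w).
case/negP; apply/andP; split; apply: score_prefers.
  by rewrite enum_rankK.
by rewrite permK !enum_rankK.
Qed.

Lemma score_stable_exists h : injective h -> score_stable h ->
  exists2 mu, stable rW rM mu & spouse mu =1 h.
Proof.
move=> hI st.
have gI : injective (fun a : 'I_#|T| => enum_rank (h (enum_val a))).
  by move=> a b /enum_rank_inj/hI/enum_val_inj.
exists (perm gI); last by move=> t; rewrite /spouse permE !enum_rankK.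
apply/forallP => w; apply/forallP => m; apply/negP => /andP[bw bm].
have [w' mE] : exists w', m = perm gI w' by exists ((perm gI)^-1 m)%g; rewrite permKV.
rewrite mE permK in bw bm.
have ww' : w != w' by apply: contraL bw => /eqP ->; rewrite /prefers ltnn.
move: bw bm => /prefers_score + /prefers_score; rewrite !permE !enum_rankK => bw bm.
by apply: (st (enum_val w) (enum_val w')) => //; rewrite (inj_eq enum_val_inj).
Qed.

Variable nu : T -> T.
Hypotheses (nuI : injective nu) (nuS : score_stable nu).
Hypothesis nuU : forall h, injective h -> score_unblocked h -> h =1 nu.

(** As there is exactly one stable marriage, lying in some and lying in every stable marriage
    coincide, so both versions of the task are treated at once. *)
Lemma pair_ok_unique every p :
  pair_ok every rW rM p = (nu (enum_val p.1) == enum_val p.2).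
Proof.
have [mu st muE] := score_stable_exists nuI nuS.
have uniq mu' : stable rW rM mu' -> (mu' p.1 == p.2) = (nu (enum_val p.1) == enum_val p.2).
  move=> /stable_score_unblocked/(nuU (@spouse_inj mu'))/(_ (enum_val p.1)) <-.
  by rewrite /spouse enum_valK (inj_eq enum_val_inj).
rewrite /pair_ok; case: every.
  apply/forallP/idP => [/(_ mu)|e mu']; first by rewrite st uniq.
  by apply/implyP => /uniq ->.
apply/existsP/idP => [[mu' /andP[/uniq ->]]//|e].
by exists mu; rewrite st uniq.
Qed.

Lemma valid_output_exists (R : realType) (eps : R) every :
  eps <= 1 -> exists S, valid_output eps every rW rM S.
Proof.
move=> eps1; exists [set (a, enum_rank (nu (enum_val a))) | a in 'I_#|T|].
apply/andP; split.
  rewrite card_imset ?card_ord; last by move=> a b [].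
  by rewrite -[leRHS]mul1r ler_wpM2r.
by apply/forall_inP => _ /imsetP[a _ ->]; rewrite pair_ok_unique /= enum_rankK.
Qed.

Lemma valid_output_spouse (R : realType) (eps : R) every S p :
  valid_output eps every rW rM S -> p \in S -> enum_val p.2 = nu (enum_val p.1).
Proof.
by move=> /andP[_ /forall_inP ok] /ok; rewrite pair_ok_unique => /eqP.
Qed.

End ScoreMarket.

(** * The chain gadget *)

Section Gadget.
Variables (k L : nat).
Local Notation K := 'I_k.
Local Notation T := (K + (K + 'I_L.+1))%type.
Implicit Types (x y : {set K * K}) (h : T -> T).

(* Women: [inl i] = w_i, [inr (inl j)] = w'_j, [inr (inr t)] = u_t;
   men: [inl j] = m_j, [inr (inl i)] = m'_i, [inr (inr t)] = v_t.
   Lower scores are preferred. *)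
Definition wscore x (a b : T) : nat :=
  (match a, b with
  | inl i, inl j => if (i, j) \in x then 0 else 2
  | inl i, inr (inl i') => if i' == i then 1 else 2
  | inr (inl j), inl j' => if j' == j then 0 else 2
  | inr (inr t), inr (inl _) => if t == 0 :> nat then 0 else 2
  | inr (inr t), inr (inr t') =>
      if t' == t :> nat then 1 else if t'.+1 == t :> nat then 0 else 2
  | _, _ => 2
  end)%N.

Definition mscore y (b a : T) : nat :=
  (match b, a with
  | inl j, inl i => if (i, j) \in y then 0 else 2
  | inl j, inr (inl j') => if j' == j then 1 else 2
  | inr (inl i), inl i' => if i' == i then 0 else 2
  | inr (inl _), inr (inr t) => if t == 0 :> nat then 1 else 2
  | inr (inr t), inr (inr t') =>
      if t' == t :> nat then 0 else if t' == t.+1 :> nat then 1 else 2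
  | _, _ => 2
  end)%N.

Definition nu_disj (a : T) : T :=
  match a with
  | inl i => inr (inl i)
  | inr (inl j) => inl j
  | inr (inr t) => inr (inr t)
  end.

(** The displacements leave over w'_j0 at one end and v_L at the other; they marry although each
    scores the other 2. *)
Definition nu_meet (i0 j0 : K) (a : T) : T :=
  match a with
  | inl i => if i == i0 then inl j0 else inr (inl i)
  | inr (inl j) => if j == j0 then inr (inr ord_max) else inl j
  | inr (inr t) => if t == 0 :> nat then inr (inl i0) else inr (inr (inord t.-1))
  end.

Lemma wscore_w_le1 x i b : (wscore x (inl i) b <= 1)%N ->
  b = inr (inl i) \/ exists2 j, b = inl j & (i, j) \in x.
Proof.
case: b => [j|[i'|t]] //=; first by case: ifP => // ij _; right; exists j.
by case: eqP => // -> _; left.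
Qed.

Lemma mscore_m_le1 y j a : (mscore y (inl j) a <= 1)%N ->
  a = inr (inl j) \/ exists2 i, a = inl i & (i, j) \in y.
Proof.
case: a => [i|[j'|t]] //=; first by case: ifP => // ij _; right; exists i.
by case: eqP => // -> _; left.
Qed.

Lemma wscore_w'_eq0 x j b : (wscore x (inr (inl j)) b <= 0)%N -> b = inl j.
Proof. by case: b => [j'|[i|t]] //=; case: eqP => // ->. Qed.

Lemma mscore_m'_eq0 y i a : (mscore y (inr (inl i)) a <= 0)%N -> a = inl i.
Proof. by case: a => [i'|[j|t]] //=; [case: eqP => // -> | case: eqP]. Qed.

Lemma mscore_m'_le1 y i a : (mscore y (inr (inl i)) a <= 1)%N ->
  a = inl i \/ a = inr (inr ord0).
Proof.
case: a => [i'|[j|t]] //=; first by case: eqP => // -> _; left.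
by case: eqP => // t0 _; right; congr (inr (inr _)); apply: val_inj.
Qed.

Lemma wscore_u_eq0 x (t : 'I_L.+1) b : (wscore x (inr (inr t)) b <= 0)%N ->
  (t = ord0 /\ exists i, b = inr (inl i)) \/
  exists2 t' : 'I_L.+1, b = inr (inr t') & t = t'.+1 :> nat.
Proof.
case: b => [j|[i|t']] //=.
  by case: eqP => // t0 _; left; split; [exact: val_inj | exists i].
by case: eqP => // _; case: eqP => // tt' _; right; exists t'.
Qed.

Lemma wscore_u_le1 x (t : 'I_L.+1) b : (wscore x (inr (inr t)) b <= 1)%N ->
  b = inr (inr t) \/ (wscore x (inr (inr t)) b <= 0)%N.
Proof.
case: b => [j|[i|t']] //=; first by case: ifP => // _ _; right.
case: eqP => [tt' _|_]; last by case: ifP => // _ _; right.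
by left; congr (inr (inr _)); apply: val_inj.
Qed.

Lemma mscore_v_eq0 y (t : 'I_L.+1) a : (mscore y (inr (inr t)) a <= 0)%N ->
  a = inr (inr t).
Proof.
case: a => [i|[j|t']] //=; case: eqP => [tt' _|_]; last by case: ifP.
by congr (inr (inr _)); apply: val_inj.
Qed.

Lemma mscore_v_le1 y (t : 'I_L.+1) a : (mscore y (inr (inr t)) a <= 1)%N ->
  a = inr (inr t) \/ exists2 t' : 'I_L.+1, a = inr (inr t') & t' = t.+1 :> nat.
Proof.
case: a => [i|[j|t']] //=; case: eqP => [tt' _|_].
  by left; congr (inr (inr _)); apply: val_inj.
by case: eqP => // tt' _; right; exists t'.
Qed.

(** * Uniqueness of the stable marriage *)

Section Stable.
Variables (x y : {set K * K}) (h : T -> T).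
Hypotheses (hI : injective h) (hS : score_unblocked (wscore x) (mscore y) h).

Lemma spouse_surj m : exists w, h w = m.
Proof. by exists (invF hI m); rewrite f_invF. Qed.

Lemma unblocked_wife w w' : (wscore x w (h w') < wscore x w (h w))%N ->
  (mscore y (h w') w' <= mscore y (h w') w)%N.
Proof. by move=> lt; rewrite leqNgt; apply/negP => lt'; exact: (@hS w w'). Qed.

Lemma unblocked_husband w w' : (mscore y (h w') w < mscore y (h w') w')%N ->
  (wscore x w (h w) <= wscore x w (h w'))%N.
Proof. by move=> lt; rewrite leqNgt; apply/negP => lt'; exact: (@hS w w'). Qed.

(** Man m'_i ranks w_i alone first, so she can always have him, and her husband scores at most 1. *)
Lemma husband_w i :
  h (inl i) = inr (inl i) \/ exists2 j, h (inl i) = inl j & (i, j) \in x.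
Proof.
have [w hw] := spouse_surj (inr (inl i)).
have [<-|wi] := eqVneq w (inl i); first by left.
suff : (wscore x (inl i) (h (inl i)) <= 1)%N by exact: wscore_w_le1.
have -> : 1%N = wscore x (inl i) (h w) by rewrite hw /= eqxx.
apply: unblocked_husband; rewrite hw /= eqxx lt0n -leqn0.
by apply: (contraNN _ wi) => /(@mscore_m'_eq0 y i w)/eqP.
Qed.

(** Woman w'_j ranks m_j alone first, so he can always have her, and his wife scores at most 1. *)
Lemma wife_m j :
  h (inr (inl j)) = inl j \/ exists2 i, h (inl i) = inl j & (i, j) \in y.
Proof.
have [w hw] := spouse_surj (inl j).
have [wj|wj] := eqVneq (h (inr (inl j))) (inl j); first by left.
have : (mscore y (inl j) w <= 1)%N.
  have -> : 1%N = mscore y (h w) (inr (inl j)) by rewrite hw /= eqxx.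
  rewrite -hw; apply: unblocked_wife; rewrite hw /= eqxx lt0n -leqn0.
  by apply: (contraNN _ wj) => /(@wscore_w'_eq0 x j _)/eqP.
case/mscore_m_le1 => [wE|[i wE ij]]; first by case/eqP: wj; rewrite -wE.
by right; exists i => //; rewrite -wE.
Qed.

Lemma husband_w_m i j : h (inl i) = inl j -> (i, j) \in x :&: y.
Proof.
move=> hij; rewrite inE; apply/andP; split.
  by case: (husband_w i) => [|[j']]; rewrite hij // => -[->].
case: (wife_m j) => [|[i']]; rewrite -hij => /hI //.
by case=> ->.
Qed.

Lemma unique_disj : x :&: y = set0 -> h =1 nu_disj.
Proof.
move=> xy0.
have hw i : h (inl i) = inr (inl i).
  by case: (husband_w i) => // -[j /husband_w_m]; rewrite xy0 inE.
have hw' j : h (inr (inl j)) = inl j.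
  by case: (wife_m j) => // -[i /husband_w_m]; rewrite xy0 inE.
(* Since v_t ranks u_t alone first, u_t could only do better with some m'_i or with v_(t-1); the
   former are taken by the w_i, the latter by induction. *)
have hu n (t : 'I_L.+1) : t = n :> nat -> h (inr (inr t)) = inr (inr t).
  elim/ltn_ind: n t => n IH t tn.
  have [w hvw] := spouse_surj (inr (inr t)).
  have [wE|wt] := eqVneq w (inr (inr t)); first by rewrite -{1}wE.
  have : (wscore x (inr (inr t)) (h (inr (inr t))) <= wscore x (inr (inr t)) (h w))%N.
    apply: unblocked_husband; rewrite hvw /= eqxx lt0n -leqn0.
    by apply: (contraNN _ wt) => /(@mscore_v_eq0 y t w)/eqP.
  have -> : wscore x (inr (inr t)) (h w) = 1%N by rewrite hvw /= eqxx.
  move=> /wscore_u_le1[//|/wscore_u_eq0[[t0 [i]]|[t' ht' tt']]].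
    by rewrite -hw => /hI.
  have t'n : (t' < n)%N by lia.
  have ht := IH _ t'n t' erefl; move: ht'; rewrite -ht => /hI e.
  by move: tt'; case: e => <-; lia.
by case=> [i|[j|t]] /=; [exact: hw | exact: hw' | exact: hu].
Qed.

Lemma unique_meet i0 j0 : x :&: y = [set (i0, j0)] -> h =1 nu_meet i0 j0.
Proof.
move=> xy0.
have hwm i j : h (inl i) = inl j -> i = i0 /\ j = j0.
  by move=> /husband_w_m; rewrite xy0 inE => /eqP[-> ->].
have [x0 y0] : (i0, j0) \in x /\ (i0, j0) \in y.
  by apply/andP; rewrite -in_setI xy0 inE.
have hw i : i != i0 -> h (inl i) = inr (inl i).
  by move=> ii0; case: (husband_w i) => // -[j /hwm[ii]]; rewrite ii eqxx in ii0.
have hw' j : j != j0 -> h (inr (inl j)) = inl j.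
  by move=> jj0; case: (wife_m j) => // -[i /hwm[_ jj]]; rewrite jj eqxx in jj0.
have hw0 : h (inl i0) = inl j0.
  case: (husband_w i0) => [e1|[j e _]]; last by rewrite e; case: (hwm _ _ e) => _ ->.
  case: (wife_m j0) => [e2|[i e _]]; last by rewrite -e; case: (hwm _ _ e) => ->.
  (* Otherwise w_i0 has m'_i0 and m_j0 has w'_j0, and (w_i0, m_j0) blocks. *)
  case: (@hS (inl i0) (inr (inl j0))); rewrite e1 e2 /= x0 y0 !eqxx //.
(* The chain: m'_i0 has lost w_i0 and ranks u_0 next, who wants some m'_i and finds all others
   taken. Then v_t, abandoned by u_t, ranks u_(t+1) next, who ranks him first. *)
have hu n (t : 'I_L.+1) : t = n :> nat -> h (inr (inr t)) = nu_meet i0 j0 (inr (inr t)).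
  elim: n t => [|n IH] t tn /=.
    rewrite tn eqxx; have tE : t = ord0 by exact: val_inj.
    rewrite {t tn}tE; have [w hvw] := spouse_surj (inr (inl i0)).
    have [<- //|wt] := eqVneq w (inr (inr ord0)).
    have : (wscore x (inr (inr ord0)) (h (inr (inr ord0))) <= wscore x (inr (inr ord0)) (h w))%N.
      apply: unblocked_husband; rewrite hvw /= ltnNge.
      apply: (contraNN _ wt) => /(@mscore_m'_le1 y i0 w)[] wE; last by rewrite wE.
      move: hvw.
      by rewrite wE hw0.
    have -> : wscore x (inr (inr ord0)) (h w) = 0%N by rewrite hvw.
    move=> /wscore_u_eq0[[_ [i]]|[t' _ //]].
    by have [-> //|/hw <-] := eqVneq i i0 => /hI.
  rewrite tn /=; have nL : (n < L.+1)%N by have := ltn_ord t; lia.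
  have sE : (inord n : 'I_L.+1) = n :> nat by rewrite inordK.
  move: (inord n) sE => s sE; have [w hvw] := spouse_surj (inr (inr s)).
  have [wE|wt] := eqVneq w (inr (inr t)); first by rewrite -{1}wE.
  have : (wscore x (inr (inr t)) (h (inr (inr t))) <= wscore x (inr (inr t)) (h w))%N.
    apply: unblocked_husband; rewrite hvw.
    have -> : mscore y (inr (inr s)) (inr (inr t)) = 1%N.
      by rewrite /= tn sE eqn_leq ltnn eqxx.
    rewrite ltnNge; apply: (contraNN _ wt) => /mscore_v_le1[wE|[t' -> t's]].
      move: hvw; rewrite wE IH //=; case: eqP => // s0 [ss].
      by move: (congr1 val ss); rewrite /= inordK; lia.
    by apply/eqP; congr (inr (inr _)); apply: val_inj; rewrite /= tn t's sE.
  have -> : wscore x (inr (inr t)) (h w) = 0%N.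
    by rewrite hvw /= tn sE eqxx eqn_leq ltnn andbF.
  move=> /wscore_u_eq0[[t0 _]|[t' -> tt']]; first by rewrite t0 in tn.
  by congr (inr (inr _)); apply: val_inj; rewrite /=; lia.
(* Every man other than v_L is already taken. *)
have hlast : h (inr (inl j0)) = inr (inr ord_max).
  case E: (h (inr (inl j0))) => [j|[i|t]].
  - have [jj|jj] := eqVneq j j0; first by move: E; rewrite jj -hw0 => /hI.
    by move: E; rewrite -(hw' j jj) => /hI e; case: e jj => ->; rewrite eqxx.
  - have [ii|/hw e] := eqVneq i i0; last by move: E; rewrite -e => /hI.
    by move: E; rewrite ii; have /= <- := hu 0%N ord0 erefl => /hI.
  congr (inr (inr _)); apply/eqP/negPn/negP => tmax.
  have tL : (t.+1 < L.+1)%N.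
    by move: tmax; rewrite -val_eqE /=; have := ltn_ord t; lia.
  move: E; have := hu t.+1 (Ordinal tL) erefl; rewrite /=.
  have -> : inord t = t by rewrite inord_val.
  by move=> <- /hI.
case=> [i|[j|t]]; last exact: hu.
  by rewrite /=; have [->|/hw] := eqVneq i i0.
by rewrite /=; have [->|/hw'] := eqVneq j j0.
Qed.

End Stable.

(** * Stability of the two marriages *)

Lemma nu_disj_inj : injective nu_disj.
Proof. by case=> [i|[j|t]] [i'|[j'|t']] //= [->]. Qed.

Lemma nu_meet_inj i0 j0 : injective (nu_meet i0 j0).
Proof.
have pred_lt (t : 'I_L.+1) : (t.-1 < L.+1)%N by have := ltn_ord t; lia.
have inord_predE (t t' : 'I_L.+1) : inord t.-1 = t' -> t.-1 = t' :> nat.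
  by move=> <-; rewrite inordK.
case=> [i|[j|t]] [i'|[j'|t']] /=.
- by case: eqP => [->|_]; case: eqP => [->|_] // [->].
- by case: eqP => [->|_]; case: eqP => // /eqP jj [jj']; rewrite jj' eqxx in jj.
- by case: eqP => [->|ii]; case: eqP => // _ [ii']; case: ii.
- by case: eqP => jj; case: eqP => // _ [jj']; case: jj.
- by case: eqP => [->|_]; case: eqP => [->|_] // [->].
- case: eqP => // _; case: eqP => // t0 [/esym/inord_predE] /= tL.
  by have := ltn_ord t'; lia.
- by case: eqP => _; case: eqP => // ii [ii']; case: ii.
- case: eqP => // t0; case: eqP => // _ [/inord_predE] /= tL.
  by have := ltn_ord t; lia.
- case: eqP => [t0|t0]; case: eqP => [t0'|t0'] //.
    by move=> _; congr (inr (inr _)); apply: val_inj; rewrite /= t0 t0'.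
  move=> [/inord_predE]; rewrite inordK // => tt'.
  by congr (inr (inr _)); apply: val_inj; rewrite /=; lia.
Qed.

(** Only m_j with (i, j) in x can tempt w_i, and he refuses since (i, j) is not in y; any man who
    tempts u_t has his unique first choice. *)
Lemma stable_disj x y : x :&: y = set0 ->
  score_stable (wscore x) (mscore y) nu_disj.
Proof.
move=> xy0 w w' ww' [].
case: w ww' => [i|[j|t]] ww'.
- rewrite {2}/nu_disj {2}/wscore eqxx => /wscore_w_le1[].
    by case: w' ww' => [i'|[j'|t']] //= ww' [ii]; rewrite ii eqxx in ww'.
  case=> j; case: w' ww' => [i'|[j'|t']] //= _ [->] ij; rewrite eqxx.
  case: ifP => // ij' _; have : (i, j) \in x :&: y by rewrite inE ij ij'.
  by rewrite xy0 inE.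
- rewrite {2}/nu_disj {2}/wscore eqxx => /wscore_w'_eq0.
  by case: w' ww' => [i'|[j'|t']] //= ww' [jj]; rewrite jj eqxx in ww'.
- rewrite {2}/nu_disj {2}/wscore eqxx => /wscore_u_le1[|/wscore_u_eq0[[t0 [i]]|[t' e tt']]].
  + by case: w' ww' => [i'|[j'|t']] //= ww' [jj]; rewrite jj eqxx in ww'.
  + by case: w' ww' => [i'|[j'|t']] //= _ _; rewrite eqxx t0.
  + by case: w' ww' e => [i'|[j'|s]] //= _ [->]; rewrite tt' (gtn_eqF (ltnSn t')) !eqxx.
Qed.

(** Every man but v_L scores his wife strictly better than w'_j0, so her bad marriage does no harm.
    Another man can tempt w_i only as m_j with (i, j) in x, outside y, and u_0 only as some m'_i,
    who prefers his wife w_i. *)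
Lemma stable_meet x y i0 j0 : x :&: y = [set (i0, j0)] ->
  score_stable (wscore x) (mscore y) (nu_meet i0 j0).
Proof.
move=> xy0 w w' ww' [].
have [x0 y0] : (i0, j0) \in x /\ (i0, j0) \in y.
  by apply/andP; rewrite -in_setI xy0 inE.
have ne : nu_meet i0 j0 w' <> nu_meet i0 j0 w.
  by move=> /nu_meet_inj e; rewrite e eqxx in ww'.
case: w ww' ne => [i|[j|t]] ww' ne.
- have le1 : (wscore x (inl i) (nu_meet i0 j0 (inl i)) <= (i != i0))%N.
    by rewrite /=; case: eqP => [->|_] /=; rewrite ?x0 ?eqxx.
  move=> /leq_trans/(_ le1) ltw.
  have /wscore_w_le1[e|[j e ij]] : (wscore x (inl i) (nu_meet i0 j0 w') <= 1)%N.
    by apply: leq_trans ltw _; case: eqP.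
    move: ltw ne; rewrite e /= eqxx; case: eqP => // _ _; by case.
  rewrite e => le; have : (mscore y (inl j) (inl i) <= 1)%N.
    apply: leq_trans le _.
    case: w' {ww' ne ltw} e => [i'|[j'|t']] /=.
    + by case: eqP => // -> [<-]; rewrite y0.
    + by case: eqP => // _ [<-]; rewrite eqxx.
    + by case: eqP.
  case/mscore_m_le1 => // -[i' [<-]] ij'.
  have : (i, j) \in x :&: y by rewrite inE ij ij'.
  by rewrite xy0 inE => /eqP[ii jj]; apply: ne; rewrite e ii jj /= eqxx.
- have [jj _|jj] := eqVneq j j0; last first.
    have -> : nu_meet i0 j0 (inr (inl j)) = inl j by rewrite /= (negbTE jj).
    rewrite [X in (_ <= X)%N]/= eqxx => /wscore_w'_eq0 e.
    by case: ne; rewrite e /= (negbTE jj).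
  rewrite jj; case: w' ww' {ne} => [i'|[j'|t']] ww' /=.
  + by case: eqP => [->|_] /=; rewrite ?y0 ?eqxx.
  + have [e|j'j0] := eqVneq j' j0; first by rewrite jj e eqxx in ww'.
    by rewrite /= eqxx eq_sym (negbTE j'j0).
  + case: eqP => [t0|t0] /=; first by rewrite t0.
    have t'L : (t'.-1 < L.+1)%N by have := ltn_ord t'; lia.
    rewrite inordK // prednK ?eqxx; last by lia.
    by case: eqP.
- have [t0|t0] := eqVneq t ord0.
    rewrite t0 /= => /(@wscore_u_eq0 x ord0 _)[[_ [i]]|[t' _] //].
    case: w' ww' {ne} => [i'|[j'|t']] /=.
    + by case: eqP => // _ _ _; rewrite /= eqxx.
    + by case: eqP.
    + move=> tt'; case: eqP => // t'0; case/eqP: tt'; congr (inr (inr _)).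
      by apply: val_inj; rewrite t0 /= t'0.
  have tn0 : (t == 0 :> nat) = false by apply: contraNF t0 => /eqP e; apply/eqP/val_inj.
  have tL : (t.-1 < L.+1)%N by have := ltn_ord t; lia.
  have -> : wscore x (inr (inr t)) (nu_meet i0 j0 (inr (inr t))) = 0%N.
    rewrite /= tn0 /= inordK // prednK ?eqxx; last by lia.
    by case: eqP => //; lia.
  move=> /wscore_u_eq0[[e _]|[t' e tt']]; first by rewrite e in tn0.
  case: ne; rewrite e /= tn0; congr (inr (inr _)); apply: val_inj.
  by rewrite /= inordK // tt'.
Qed.

End Gadget.

(** * Reduction from unique disjointness *)

Lemma success_prob_mono (R : realType) (X Y O : Type) (D : rproto R X Y O)
    (ok ok' : pred O) x y :
  is_distribution D -> (forall o, ok o -> ok' o) ->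
  success_prob D ok x y <= success_prob D ok' x y.
Proof.
move=> /rproto_sum[m [w [p [w0 _ _ pE]]]] okok'; rewrite !pE.
apply: ler_sum => i _; rewrite ler_wpM2l // ler_nat.
by have := okok' (run (p i) x y); case: (ok _) => // ->.
Qed.

Lemma success_probC (R : realType) (X Y O : Type) (D : rproto R X Y O)
    (ok : pred O) x y :
  is_distribution D -> success_prob D (predC ok) x y = 1 - success_prob D ok x y.
Proof.
move=> /rproto_sum[m [w [p [_ w1 _ pE]]]].
apply: (@addIr _ (success_prob D ok x y)); rewrite subrK !pE -big_split -[RHS]w1.
by apply: eq_bigr => i _ /=; case: (ok _); rewrite ?mulr1 ?mulr0 ?addr0 ?add0r.
Qed.

Section Reduction.
Variables (R : realType) (eps : R) (every : bool) (k L : nat).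
Local Notation T := ('I_k + ('I_k + 'I_L.+1))%type.
Local Notation rW x := (score_profile (@wscore k L x)).
Local Notation rM y := (score_profile (@mscore k L y)).

(** The test reads the output alone, so the reduction costs no communication. *)
Definition accepts (S : {set 'I_#|{: T}| * 'I_#|{: T}|}) : bool :=
  [exists t : 'I_L.+1, (enum_rank (inr (inr t) : T), enum_rank (inr (inr t) : T)) \in S].

(** Only 2k pairs of [nu_disj] lie off the chain, fewer than the output must contain. *)
Lemma valid_output_disj x y S : (k + k)%:R < eps * #|{: T}|%:R ->
  x :&: y = set0 -> valid_output eps every (rW x) (rM y) S -> accepts S.
Proof.
move=> kn xy0 ok; apply: contraT; rewrite negb_exists => /forallP noS.
have spE p : p \in S -> enum_val p.2 = nu_disj (enum_val p.1).
  apply: (valid_output_spouse (@nu_disj_inj k L) (stable_disj xy0) _ ok).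
  by move=> h hI hS; exact: (unique_disj hI hS).
pose emb (c : 'I_k + 'I_k) : T := match c with inl i => inl i | inr j => inr (inl j) end.
have sub : S \subset [set (enum_rank (emb c), enum_rank (nu_disj (emb c))) | c : 'I_k + 'I_k].
  apply/subsetP => -[a b] ab; have /= bE := spE _ ab; apply/imsetP.
  have abE (c : T) : enum_val a = c -> (a, b) = (enum_rank c, enum_rank (nu_disj c)).
    by move=> ac; rewrite -ac -bE !enum_valK.
  case aE: (enum_val a) => [i|[j|t]].
  - by exists (inl i) => //; exact: abE.
  - by exists (inr j) => //; exact: abE.
  - by have := noS t; rewrite -[X in X \notin _](abE _ aE) ab.
have /andP[cardS _] := ok.
have := lt_le_trans kn cardS; rewrite ltr_nat ltnNge.
rewrite (leq_trans (subset_leq_card sub)) //.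
by rewrite (leq_trans (leq_imset_card _ _)) // card_sum card_ord.
Qed.

Lemma valid_output_meet x y p0 S :
  x :&: y = [set p0] -> valid_output eps every (rW x) (rM y) S -> ~~ accepts S.
Proof.
case: p0 => i0 j0 xy0 ok; apply/existsPn => t; apply/negP => tS.
have : enum_val (enum_rank (inr (inr t) : T)) =
    nu_meet i0 j0 (enum_val (enum_rank (inr (inr t) : T))).
  apply: (valid_output_spouse (@nu_meet_inj k L i0 j0) (stable_meet xy0) _ ok tS).
  by move=> h hI hS; exact: (unique_meet hI hS).
rewrite enum_rankK /=; case: eqP => // t0 [tE].
by move: (congr1 val tE); rewrite /= inordK; have := ltn_ord t; lia.
Qed.

Lemma gadget_lower_bound
    (D : rproto R (profile #|{: T}|) (profile #|{: T}|)
           {set 'I_#|{: T}| * 'I_#|{: T}|}) (l : R) :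
  0 < l <= 1 / 120 -> (0 < k)%N -> eps <= 1 -> (k + k)%:R < eps * #|{: T}|%:R ->
  solves eps every D -> l ^+ 2 * (k * k)%:R - 60 / l <= (rcost D)%:R :> R.
Proof.
move=> hl k0 eps1 kn [Dd Ds].
have -> : (k * k)%N = #|{: 'I_k * 'I_k}| by rewrite card_prod card_ord.
apply: (@udisj_lower_bound R _ _ _ _ D (fun x => rW x) (fun y => rM y) accepts) => //.
- by rewrite card_prod card_ord muln_gt0 k0.
- move=> x y xy0; apply: le_trans (Ds (rW x) (rM y) _) _.
    apply: (valid_output_exists (@nu_disj_inj k L) (stable_disj xy0)) => //.
    by move=> h hI hS; exact: (unique_disj hI hS).
  by apply: success_prob_mono => // S; exact: valid_output_disj.
move=> x y [i0 j0] xy0.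
have : 2 / 3 <= success_prob D (predC accepts) (rW x) (rM y).
  apply: le_trans (Ds (rW x) (rM y) _) _.
    apply: (valid_output_exists (@nu_meet_inj k L i0 j0) (stable_meet xy0)) => //.
    by move=> h hI hS; exact: (unique_meet hI hS).
  by apply: success_prob_mono => // S; exact: valid_output_meet xy0.
rewrite success_probC // => h; lra.
Qed.

End Reduction.

(** * Choice of parameters *)

Theorem theorem12 (R : realType) (eps : R) :
  0 < eps <= 1 ->
  forall every : bool,
  exists c : R, 0 < c /\
  exists N : nat, forall n : nat, (N <= n)%N ->
    forall D : rproto R (profile n) (profile n) {set 'I_n * 'I_n},
      solves eps every D -> c * (n%:R) ^+ 2 <= (rcost D)%:R.
Proof.
move=> /andP[eps0 eps1] every.
have [l hl] : exists l : R, 0 < l <= 1 / 120 by exists (1 / 120); lra.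
have [l0 _] := andP hl.
(* With k >= eps n / 8 the main term is at least 2 c n^2; one half of it absorbs b. *)
pose c := l ^+ 2 * eps ^+ 2 / 128; pose b := 60 / l.
have c0 : 0 < c by rewrite divr_gt0 ?mulr_gt0 ?exprn_gt0.
have b0 : 0 < b by rewrite divr_gt0.
(* Beyond b/c one has b <= c n^2; beyond 8/eps, rounding eps n / 4 down leaves at least eps n /
   8. *)
exists c; split=> //; exists (Num.truncn (b / c + 8 / eps)).+1 => n Nn D sol.
have nbig : b / c + 8 / eps < n%:R.
  by apply: lt_le_trans (truncnS_gt _) _; rewrite ler_nat.
have q0 : 0 < b / c by rewrite divr_gt0.
have e0 : 0 < 8 / eps by rewrite divr_gt0.
have n8 : 8 < eps * n%:R by rewrite mulrC -ltr_pdivrMr //; lra.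
have n1 : 1 <= n%:R :> R by rewrite ler1n; case: (n) Nn.
have cn : b <= c * n%:R ^+ 2.
  have : b < n%:R * c by rewrite -ltr_pdivrMr //; lra.
  have : n%:R * c <= n%:R * c * n%:R by rewrite ler_peMr // mulr_ge0 ?ler0n // ltW.
  by rewrite expr2; lra.
pose k := Num.truncn (eps * n%:R / 4).
have /andP[k1 k2] : k%:R <= eps * n%:R / 4 < k.+1%:R.
  by apply: truncn_itv; rewrite divr_ge0 // mulr_ge0 ?ler0n // ltW.
have en : eps * n%:R <= n%:R by rewrite ler_piMl.
move: k1 k2; rewrite -[k.+1%:R]natr1; move: k => k k1 k2.
have k0 : (0 < k)%N by rewrite -(ltr0n R); lra.
have kn : (k + k < n)%N by rewrite -(ltr_nat R) natrD; lra.
(* The chain fills the market up to size n; its length L + 1 = n - 2k is positive. *)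
have [L nE] : exists L, n = #|{: 'I_k + ('I_k + 'I_L.+1)}|.
  by clear - kn; exists (n - (k + k)).-1; rewrite !card_sum !card_ord; lia.
have ksq : (eps * n%:R / 8) ^+ 2 <= (k * k)%:R.
  by rewrite natrM -expr2 lerXn2r ?nnegrE ?ler0n //; lra.
have kk : (k + k)%:R < eps * n%:R by rewrite natrD; lra.
have low : l ^+ 2 * (k * k)%:R - b <= (rcost D)%:R.
  clear - hl k0 eps1 sol kk nE.
  by move: D sol kk; rewrite nE {n nE} => D sol kk; exact: (gadget_lower_bound hl k0 eps1 kk sol).
have cE : c * n%:R ^+ 2 = l ^+ 2 * (eps * n%:R / 8) ^+ 2 / 2 by rewrite /c; field.
by have := ler_wpM2l (sqr_ge0 l) ksq; lra.
Qed.
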